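(* Let $G$ be a caterpillar with $n$ vertices. Then the burning number of $G$ satisfies $b(G)\leq \left\lceil\sqrt{n}\right\rceil$.
   Context: All graphs are finite, simple and undirected. Burning a graph $G$ proceeds in discrete rounds: in round $1$ one vertex is set on fire; in each subsequent round, first the fire spreads from every burning vertex to all its neighbours, and then one additional (not necessarily non-burning) vertex may be set on fire. Burning vertices stay burning. The burning number $b(G)$ is the minimum number of rounds after which all vertices are burning. Equivalently, $b(G)$ is the least $k$ for which there are vertices $x_1,\dots,x_k$ such that every vertex of $G$ is at distance at most $k-i$ from $x_i$ for some $i\in\{1,\dots,k\}$. A caterpillar is a tree in which every vertex is at distance at most one from a central path (the spine); equivalently, a tree that becomes a path when all its leaves are removed. *)

(* Defs.v *)
From mathcomp Require Import all_boot.

Set Implicit Arguments.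
Unset Strict Implicit.
Unset Printing Implicit Defensive.

(* A finite simple graph is a symmetric irreflexive relation e on a finType. *)

Definition acyclic (T : finType) (e : rel T) : Prop :=
  forall c : seq T, 2 < size c -> ~ ucycle e c.

Definition is_tree (T : finType) (e : rel T) : Prop :=
  [/\ 0 < #|T|, forall x y : T, connect e x y & acyclic e].

(* The spine is the simple path x :: p; being at distance at most one from a
   vertex means being equal or adjacent to it. *)
Definition caterpillar (T : finType) (e : rel T) : Prop :=
  is_tree e /\
  exists x : T, exists p : seq T,
    [/\ path e x p, uniq (x :: p) &
        forall v : T, exists2 u : T, u \in x :: p & (v == u) || e v u].

Definition spread (T : finType) (e : rel T) (B : {set T}) : {set T} :=
  B :|: [set y | [exists x in B, e x y]].

Definition burn_round (T : finType) (e : rel T) (B : {set T}) (o : option T) :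
    {set T} :=
  spread e B :|: (if o is Some x then [set x] else set0).

(* s lists the choices made in rounds 1, 2, ..., None standing for a round in
   which no additional vertex is set on fire. *)
Definition burnt (T : finType) (e : rel T) (s : seq (option T)) : {set T} :=
  foldl (burn_round e) set0 s.

(* A vertex must be set on fire in round 1, whereas later choices are optional. *)
Definition starts_fire (T : finType) (s : seq (option T)) : bool :=
  if s is o :: _ then isSome o else true.

Definition burnable_in (T : finType) (e : rel T) (k : nat) : bool :=
  [exists s : k.-tuple (option T), starts_fire s && (burnt e s == [set: T])].

Lemma burnable_card (T : finType) (e : rel T) : burnable_in e #|T|.
Proof.
have sz : size (map Some (enum T)) == #|T| by rewrite size_map -cardE.
apply/existsP; exists (Tuple sz) => /=; apply/andP; split.
  by case: (enum T).
rewrite -subTset; apply/subsetP => x _.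
have : x \in enum T by rewrite mem_enum.
rewrite /burnt; elim/last_ind: (enum T) => [//|r y IH].
rewrite map_rcons foldl_rcons mem_rcons in_cons /burn_round /spread !inE.
by case/predU1P => [->|/IH ->]; rewrite ?eqxx ?orbT.
Qed.

Lemma burnable_exists (T : finType) (e : rel T) : exists k, burnable_in e k.
Proof. by exists #|T|; apply: burnable_card. Qed.

Definition burning_number (T : finType) (e : rel T) : nat :=
  ex_minn (burnable_exists e).

(* Main.v *)
Require Import Defs.
From mathcomp Require Import all_boot all_order all_algebra.
From mathcomp Require Import reals.
From mathcomp Require Import zify.

(** Write the caterpillar as its spine v_0, v_1, ... with a list of leaves at
    each spine vertex, where v_0 may be assumed to carry no leaf (otherwise one
    of its leaves extends the spine).  A ball of radius r around v_r covers
    v_0, ..., v_{2r} and all leaves at v_0, ..., v_{2r-1}.  Let r = k - 1 be the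
    largest available radius and suppose that there are at most k^2 vertices.
    If v_{2r} has no leaf, or if some earlier v_i has one, then this ball lets us
    cut off an initial piece with at least 2r + 1 = k^2 - (k-1)^2 vertices.
    Otherwise v_0, ..., v_{2r-1} carry no leaf and v_{2r} does.  A ball of radius
    r - 1 then takes v_0, ..., v_{2r-2}, and since the remaining spine
    v_{2r-1}, v_{2r}, ... has a leaf at its second vertex, the ball of radius r
    again cuts off at least 2r + 1 vertices; together these are
    4r = k^2 - (k-2)^2 vertices.  In both cases induction on k applies. *)

(** * Fire and balls in an arbitrary graph *)

Section Burning.

Variables (T : finType) (e : rel T).

Definition ball (r : nat) (c : T) : {set T} := iter r (spread e) [set c].

Lemma spreadS (A B : {set T}) : A \subset B -> spread e A \subset spread e B.
Proof.
move=> /subsetP AB; apply/subsetP => y; rewrite !inE.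
case/orP => [/AB -> //|/exists_inP [x /AB xB exy]].
by apply/orP; right; apply/exists_inP; exists x.
Qed.

Lemma burn_roundS (A B : {set T}) (o : option T) :
  A \subset B -> burn_round e A o \subset burn_round e B o.
Proof. by move=> AB; rewrite /burn_round setSU // spreadS. Qed.

Lemma foldl_burn_roundS (s : seq (option T)) (A B : {set T}) :
  A \subset B -> foldl (burn_round e) A s \subset foldl (burn_round e) B s.
Proof. by elim: s A B => //= o s IH A B AB; apply: IH; apply: burn_roundS. Qed.

(** The extra first round ends in a superset of [set0], and all later rounds preserve inclusion. *)
Lemma burnt_sub_cons (o : option T) (s : seq (option T)) :
  burnt e s \subset burnt e (o :: s).
Proof. by apply: foldl_burn_roundS; apply: sub0set. Qed.

(** The fire at [c] is lit first, so it spreads once for each later choice. *)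
Lemma ball_sub_burnt (c : T) (s : seq (option T)) :
  ball (size s) c \subset burnt e (Some c :: s).
Proof.
elim/last_ind: s => [|s o IH]; first by rewrite /burnt /= /burn_round subsetUr.
rewrite size_rcons -rcons_cons /burnt foldl_rcons /=.
by apply: subset_trans (spreadS _ _ IH) _; apply: subsetUl.
Qed.

Lemma ball_adj (r : nat) (c v w : T) :
  v \in ball r c -> e v w -> w \in ball r.+1 c.
Proof.
by move=> vB evw; rewrite /= !inE; apply/orP; right; apply/exists_inP; exists v.
Qed.

Lemma ball_leq (r r' : nat) (c : T) : r <= r' -> ball r c \subset ball r' c.
Proof.
move=> /subnK <-; elim: (r' - r) => //= d IH.
by apply: subset_trans IH _; apply: subsetUl.
Qed.

Lemma burning_number_le (s : seq T) :
  (forall v, v \in burnt e [seq Some x | x <- s]) ->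
  burning_number e <= size s.
Proof.
move=> sB; rewrite /burning_number; case: ex_minnP => m _; apply.
have sz : size [seq Some x | x <- s] == size s by rewrite size_map.
apply/existsP; exists (Tuple sz); apply/andP; split => /=; first by case: (s).
by rewrite -subTset; apply/subsetP => v _; apply: sB.
Qed.

Section Caterpillars.

Hypothesis e_sym : symmetric e.

Lemma sorted_ball (x0 : T) (s : seq T) (i j r : nat) :
  sorted e s -> i < size s -> j < size s -> i <= j + r -> j <= i + r ->
  nth x0 s i \in ball r (nth x0 s j).
Proof.
move=> /(sortedP x0) step.
have up a d : a + d < size s -> nth x0 s (a + d) \in ball d (nth x0 s a).
  elim: d => [|d IH] lt_ad; first by rewrite addn0 inE.
  by rewrite addnS in lt_ad *; apply: (ball_adj _ _ _ _ (IH (ltnW lt_ad))); apply: step.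
have dn d a : a + d < size s -> nth x0 s a \in ball d (nth x0 s (a + d)).
  elim: d a => [|d IH] a lt_ad; first by rewrite addn0 inE.
  have lt_a : a.+1 + d < size s by rewrite addSnnS.
  rewrite addnS -addSn; apply: (ball_adj _ _ _ _ (IH _ lt_a)).
  by rewrite e_sym; apply: step; lia.
move=> ltis ltjs leij leji; have [le_ij | /ltnW le_ji] := leqP i j.
  apply: (subsetP (ball_leq (j - i) r _ _)); first lia.
  by rewrite -{2}(subnKC le_ij); apply: dn; rewrite subnKC.
apply: (subsetP (ball_leq (i - j) r _ _)); first lia.
by rewrite -{1}(subnKC le_ji); apply: up; rewrite subnKC.
Qed.

(* A caterpillar is encoded as its spine, each spine vertex being paired with
   the list of the leaves hanging at it. *)
Implicit Type cs : seq (T * seq T).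

Definition legged cs : bool :=
  sorted e [seq c.1 | c <- cs] && all (fun c => all (e c.1) c.2) cs.

Definition vertices cs : seq T := flatten [seq c.1 :: c.2 | c <- cs].

Definition legs cs : seq T := flatten [seq c.2 | c <- cs].

(** * Cutting an initial piece off the spine *)

Lemma size_vertices cs : size (vertices cs) = size cs + size (legs cs).
Proof.
elim: cs => //= c cs IH.
by rewrite /vertices /legs /= !size_cat -/(vertices cs) -/(legs cs) IH; lia.
Qed.

Lemma vertices_take_drop m cs :
  vertices cs = vertices (take m cs) ++ vertices (drop m cs).
Proof. by rewrite /vertices -flatten_cat -map_cat cat_take_drop. Qed.

Lemma legged_drop m cs : legged cs -> legged (drop m cs).
Proof.
case/andP => s_e /allP l_e; apply/andP; split.
  by rewrite map_drop; apply: drop_sorted.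
by apply/allP => c /mem_drop; apply: l_e.
Qed.

(** A leaf at an index strictly between [0] and [2 * r] hangs at a vertex within [r - 1] of the
    centre; the assumptions on [leg] and [m] exclude leaves at the two extreme indices. *)
Lemma ball_prefix (x0 : T) (r m : nat) cs :
  let leg i := (nth (x0, [::]) cs i).2 in
  legged cs -> 0 < size cs -> leg 0 = [::] ->
  m <= (2 * r).+1 -> m <= 2 * r \/ leg (2 * r) = [::] ->
  exists c : T, {subset vertices (take m cs) <= ball r c}.
Proof.
move=> leg /andP [s_e l_e] cs0 leg0 le_m leg2r.
(* If the spine ends before index [r], its last vertex serves as centre. *)
pose q := minn r (size cs).-1; have ltq : q < size cs by rewrite /q; lia.
exists (nth x0 [seq c.1 | c <- cs] q) => v /flatten_mapP [[u l]].
case/(nthP (x0, [::])) => i; rewrite size_take_min leq_min => /andP [lti lti'].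
rewrite nth_take // => nthi; have {}lti' : i < size cs := lti'.
have u_def : u = nth x0 [seq c.1 | c <- cs] i.
  by rewrite (nth_map (x0, [::])) // nthi.
rewrite /= inE => /predU1P [-> | vl].
  by rewrite u_def; apply: sorted_ball; rewrite ?size_map // /q; lia.
have legi : leg i <> [::] by rewrite /leg nthi /= => l0; rewrite l0 in vl.
have i0 : i <> 0 by move=> i0; rewrite i0 in legi.
have i2r : i <> 2 * r by move=> i2r; case: leg2r => [|h]; [lia | rewrite i2r in legi].
have rE : r = r.-1.+1 by lia.
rewrite {1}rE; apply: (ball_adj _ _ u).
  by rewrite u_def; apply: sorted_ball; rewrite ?size_map // /q; lia.
have := allP l_e (u, l); rewrite -nthi mem_nth // nthi => /(_ isT) /allP; exact.
Qed.

(** A leaf at index [2 * r] may be out of reach of the ball, so that index is cut off only when it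
    carries none. *)
Definition cut (x0 : T) (r : nat) cs : nat :=
  if nilp (nth (x0, [::]) cs (2 * r)).2 then (2 * r).+1 else 2 * r.

Lemma ball_cut (x0 : T) (r : nat) cs :
  legged cs -> 0 < size cs -> (nth (x0, [::]) cs 0).2 = [::] ->
  exists c : T, {subset vertices (take (cut x0 r cs) cs) <= ball r c}.
Proof.
move=> cs_e cs0 leg0; apply: (ball_prefix x0) => //.
  by rewrite /cut; case: ifP.
by rewrite /cut; case: ifP => [/nilP|]; [right | left].
Qed.

(** The piece has [2 * r + 1] spine vertices, or [2 * r] of them and a leaf; if the spine is no
    longer than the cut, nothing remains. *)
Lemma size_drop_cut (x0 : T) (r : nat) cs :
  nilp (nth (x0, [::]) cs (2 * r)).2 || ~~ nilp (legs (take (2 * r) cs)) ->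
  size (vertices (drop (cut x0 r cs) cs)) <= size (vertices cs) - (2 * r).+1.
Proof.
move=> h; set m := cut _ _ _; have [le_m | lt_m] := leqP (size cs) m.
  by rewrite drop_oversize.
rewrite (vertices_take_drop m cs) size_cat.
suff : (2 * r).+1 <= size (vertices (take m cs)) by lia.
rewrite size_vertices size_takel ?(ltnW lt_m) //.
move: h; rewrite /m /cut; case: ifP => [_ _ | _]; first lia.
by rewrite /nilp -lt0n /=; lia.
Qed.

Lemma nilp_legsP (x0 : T) cs :
  reflect (forall i, (nth (x0, [::]) cs i).2 = [::]) (nilp (legs cs)).
Proof.
elim: cs => [|c cs IH]; first by left=> i; rewrite nth_nil.
rewrite /legs /= cat_nilp -/(legs cs); apply: (iffP andP).
  by case=> /nilP c0 /IH cs0 [|i] //=; apply: cs0.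
by move=> h; split; [apply/nilP; apply: (h 0) | apply/IH => i; apply: (h i.+1)].
Qed.

Lemma burnt_cut (c : T) (m : nat) cs (s : seq T) :
  {subset vertices (take m cs) <= ball (size s) c} ->
  {subset vertices (drop m cs) <= burnt e [seq Some x | x <- s]} ->
  {subset vertices cs <= burnt e [seq Some x | x <- c :: s]}.
Proof.
move=> h1 h2 v; rewrite (vertices_take_drop m cs) mem_cat => /orP [/h1 | /h2].
  by apply: subsetP; rewrite -(size_map Some); apply: ball_sub_burnt.
by apply: subsetP; apply: burnt_sub_cons.
Qed.

Lemma legged_extend (l u : T) (ls : seq T) cs :
  legged ((u, l :: ls) :: cs) -> legged ((l, [::]) :: (u, ls) :: cs).
Proof.
case/andP => /= s_e /andP [/andP [eul ls_e] cs_e].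
by rewrite /legged /= e_sym eul s_e ls_e.
Qed.

Lemma legged_burnt (x0 : T) (k : nat) cs :
  legged cs -> size (vertices cs) <= k ^ 2 ->
  exists2 s : seq T, size s = k &
    {subset vertices cs <= burnt e [seq Some x | x <- s]}.
Proof.
elim/ltn_ind: k cs => k IH cs cs_e sz_cs.
wlog leg0 : cs cs_e sz_cs / (nth (x0, [::]) cs 0).2 = [::].
  move=> wlog_cs; case: cs cs_e sz_cs => [|[u [|l ls]] cs] cs_e sz_cs;
    [exact: wlog_cs | exact: wlog_cs |].
  have [s sz_s sB] := wlog_cs _ (legged_extend _ _ _ _ cs_e) sz_cs erefl.
  by exists s => // v; rewrite !inE orbCA => v_cs; apply: sB; rewrite !inE.
have [cs0 | cs_gt0] := posnP (size cs).
  by exists (nseq k x0); rewrite ?size_nseq // (size0nil cs0).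
case: k => [|r] in IH sz_cs *; first by rewrite size_vertices in sz_cs; lia.
pose cutable := nilp (nth (x0, [::]) cs (2 * r)).2 || ~~ nilp (legs (take (2 * r) cs)).
have [h | ] := boolP cutable.
  have [c cB] := ball_cut x0 r cs cs_e cs_gt0 leg0.
  have sz_d := size_drop_cut x0 r cs h.
  have [|s sz_s sB] := IH r (ltnSn r) _ (legged_drop (cut x0 r cs) cs cs_e); first nia.
  exists (c :: s); first by rewrite /= sz_s.
  by apply: burnt_cut sB; rewrite sz_s.
rewrite negb_or negbK => /andP [leg2r /(nilp_legsP x0) no_leg].
have leg_lt i : i < 2 * r -> (nth (x0, [::]) cs i).2 = [::].
  by move=> lti; have := no_leg i; rewrite nth_take.
(* Radius 0 would put a leaf at index 0. From here on the two largest radii are [r.+1] and [r]. *)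
case: r => [|r] in IH sz_cs cutable leg2r no_leg leg_lt *.
  by rewrite leg0 in leg2r.
have m1 : cut x0 r cs = (2 * r).+1 by rewrite /cut leg_lt //; lia.
have [c1 c1B] := ball_cut x0 r cs cs_e cs_gt0 leg0.
have sz_d1 : size (vertices (drop (cut x0 r cs) cs)) <= size (vertices cs) - (2 * r).+1.
  by apply: size_drop_cut; rewrite leg_lt //; lia.
have lt_cs : 2 * r.+1 < size cs.
  by rewrite ltnNge; apply: contra leg2r => le_cs; rewrite nth_default.
set ds := drop (cut x0 r cs) cs in sz_d1 *.
have ds_e : legged ds by apply: legged_drop.
have ds_gt0 : 0 < size ds by rewrite size_drop m1; lia.
have dsleg0 : (nth (x0, [::]) ds 0).2 = [::] by rewrite nth_drop m1 leg_lt //; lia.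
(* Index 1 of [ds] is index [2 * r.+1] of [cs], which carries a leaf. *)
have dsleg1 : ~~ nilp (legs (take (2 * r.+1) ds)).
  apply: contra leg2r => /(nilp_legsP x0) /(_ 1); rewrite nth_take; last lia.
  by rewrite nth_drop m1 (_ : _ + 1 = 2 * r.+1) => [->|]; last lia.
have [c2 c2B] := ball_cut x0 r.+1 ds ds_e ds_gt0 dsleg0.
have sz_d2 : size (vertices (drop (cut x0 r.+1 ds) ds)) <= size (vertices ds) - (2 * r.+1).+1.
  by apply: size_drop_cut; rewrite dsleg1 orbT.
(* The count is [(r + 2) ^ 2 - (2 * r + 1) - (2 * r + 3) = r ^ 2]. *)
have [|s sz_s sB] := IH r (leqnSn _) _ (legged_drop (cut x0 r.+1 ds) ds ds_e); first nia.
exists (c2 :: c1 :: s); first by rewrite /= sz_s.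
(* The ball of radius r comes first along the spine but burns second. *)
move=> v; rewrite (vertices_take_drop (cut x0 r cs) cs) -/ds mem_cat => /orP [/c1B | v_ds].
  move=> vB; apply: (subsetP (burnt_sub_cons _ _)).
  by apply: (subsetP (ball_sub_burnt _ _)); rewrite size_map sz_s.
move: v v_ds; apply: burnt_cut; first by rewrite /= sz_s; apply: c2B.
by move=> v /sB; apply: (subsetP (burnt_sub_cons _ _)).
Qed.

End Caterpillars.

(** * Encoding a caterpillar as a spine with leaves *)

Lemma size_flatten_fibers (f : T -> T) (s l : seq T) :
  uniq s ->
  size (flatten [seq [seq v <- l | f v == u] | u <- s]) =
  count (fun v => f v \in s) l.
Proof.
elim: s => [_|u s IH /= /andP [us s_uniq]]; first by rewrite /= count_pred0.
rewrite size_cat size_filter IH // -count_predUI.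
(* The overlap is empty because [u] does not occur in [s]. *)
rewrite [X in _ + X](_ : _ = 0) ?addn0; last first.
  apply/eqP; rewrite -leqn0 leqNgt -has_count; apply/hasPn => v _ /=.
  by apply/negP => /andP [/eqP ->]; apply/negP.
by apply: eq_count => v; rewrite inE.
Qed.

(** Hanging each vertex off the spine at one chosen spine neighbour lists no vertex twice, which
    gives the size bound. *)
Lemma caterpillar_legged :
  symmetric e -> caterpillar e ->
  exists2 cs, legged cs &
    (forall v, v \in vertices cs) /\ size (vertices cs) <= #|T|.
Proof.
move=> e_sym [_ [x [p [p_e p_uniq adj]]]]; set S := x :: p in p_uniq adj.
(* The default [x] is never reached for [v] off the spine. *)
pose f v := odflt x [pick u in S | e v u].
have fP v : v \notin S -> f v \in S /\ e (f v) v.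
  move=> vS; rewrite /f; case: pickP => [u /andP [uS evu] /= | none].
    by rewrite e_sym.
  have [u uS /orP [/eqP vu | evu]] := adj v; first by rewrite -vu (negPf vS) in uS.
  by have := none u; rewrite uS evu.
pose l := [seq v <- enum T | v \notin S].
pose g u := [seq v <- l | f v == u].
exists [seq (u, g u) | u <- S].
  rewrite /legged -map_comp map_id; apply/andP; split=> //.
  apply/allP => _ /mapP [u _ ->]; apply/allP => v /=.
  by rewrite !mem_filter => /andP [/eqP <- /andP [/fP []]].
split=> [v|].
  rewrite /vertices -map_comp; apply/flatten_mapP.
  have [vS | vS] := boolP (v \in S); first by exists v => //=; rewrite inE eqxx.
  have [fS _] := fP v vS; exists (f v) => //=.
  by rewrite inE mem_filter eqxx mem_filter vS mem_enum orbT.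
rewrite size_vertices size_map /legs -map_comp size_flatten_fibers //.
rewrite -(card_uniqP p_uniq) -(cardC (mem S)) leq_add2l.
apply: leq_trans (count_size _ _) _.
rewrite /l size_filter enumT cardE [X in _ <= X]size_filter; apply: eq_leq.
by apply: eq_count => v; rewrite !inE.
Qed.

Lemma burning_number_caterpillar (k : nat) :
  symmetric e -> caterpillar e -> #|T| <= k ^ 2 -> burning_number e <= k.
Proof.
move=> e_sym e_cat le_Tk; have [cs cs_e [cs_all sz_cs]] := caterpillar_legged e_sym e_cat.
have [_ [x0 _]] := e_cat.
have [s <- sB] := legged_burnt e_sym x0 k cs cs_e (leq_trans sz_cs le_Tk).
by apply: burning_number_le => v; apply: sB.
Qed.

End Burning.

Import Order.TTheory GRing.Theory Num.Theory.

Local Open Scope ring_scope.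

Theorem mainTheorem1 (R : realType) (T : finType) (e : rel T) (n : nat)
    (e_sym : symmetric e) (e_irr : irreflexive e)
    (e_cat : caterpillar e) (card_T : #|T| = n) :
  (burning_number e)%:Z <= Num.ceil (Num.sqrt (n%:R : R)).
Proof.
set c := Num.ceil _.
have c_ge0 : 0 <= c by rewrite -(ceil0 R) le_ceil // sqrtr_ge0.
rewrite -(gez0_abs c_ge0) lez_nat; apply: burning_number_caterpillar => //.
(* Writing [n] as the square of its root reduces the bound to the root being at most its ceiling. *)
rewrite card_T -(ler_nat R) natrX -(sqr_sqrtr (ler0n R n)) lerXn2r ?nnegrE ?sqrtr_ge0 //.
by rewrite natr_absz ger0_norm // ceil_ge.
Qed.
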